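(* Let $X_1,X_2,\ldots$ be i.i.d. random variables with $\mathbb E X_k=0$, $\operatorname{Var}X_k=1$, such that $\varphi(t)=\log\mathbb Ee^{tX_1}$ is finite on $[0,t_0)$ for some $t_0>0$. Assume that for some $\alpha<2$ we have $\mathbb P[X_1>x]>e^{-x^\alpha}$ for all sufficiently large $x$. Then for every $a>0$, $$\lim_{n\to\infty}\mathbb P[\mathbf M_n=\mathbf M_n(1,a\log n)]=1.$$
   Context: $S_0=0$, $S_k=X_1+\cdots+X_k$, $\mathbf M_n=\max_{0\leq i<j\leq n}\frac{S_j-S_i}{\sqrt{j-i}}$, and for $0\leq h_1<h_2$, $\mathbf M_n(h_1,h_2)$ is the same maximum restricted to pairs with $h_1\leq j-i\leq h_2$. *)

(* Defs.v *)
From HB Require Import structures.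
From mathcomp Require Import all_boot all_order all_algebra.
From mathcomp Require Import all_classical all_reals all_analysis.
Set Implicit Arguments. Unset Strict Implicit. Unset Printing Implicit Defensive.
Import Order.TTheory GRing.Theory Num.Theory.
Import numFieldNormedType.Exports.
Local Open Scope classical_set_scope.
Local Open Scope ring_scope.

Section defs.
Context {d : measure_display} {T : measurableType d} {R : realType}
  (P : probability T R).

Definition mutually_independent (X : nat -> T -> R) : Prop :=
  forall (I : seq nat) (B : nat -> set R), uniq I ->
    (forall i, measurable (B i)) ->
    P (\bigcap_(i in [set` I]) (X i @^-1` B i)) =
    (\prod_(i <- I) P (X i @^-1` B i))%E.

Definition identically_distributed (X : nat -> T -> R) : Prop :=
  forall (i : nat) (B : set R), measurable B ->
    P (X i @^-1` B) = P (X 0%N @^-1` B).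

End defs.

(* X k plays the role of X_{k+1}; partial sum S_k = X_1 + ... + X_k. *)
Definition psum {T : Type} {R : realType} (X : nat -> T -> R) (k : nat) (w : T) : R :=
  \sum_(i < k) X i w.

(* M_n = max_{0 <= i < j <= n} (S_j - S_i)/sqrt(j - i)  (value -oo if n = 0). *)
Definition Mmax {T : Type} {R : realType} (X : nat -> T -> R) (n : nat) (w : T)
  : \bar R :=
  \big[maxe/-oo%E]_(j < n.+1) \big[maxe/-oo%E]_(i < j)
     ((psum X j w - psum X i w) / Num.sqrt (j - i)%:R)%:E.

(* M_n(h1,h2): same maximum restricted to pairs with h1 <= j - i <= h2
   (value -oo if there is no such pair). *)
Definition Mmax_restr {T : Type} {R : realType} (X : nat -> T -> R)
  (h1 h2 : R) (n : nat) (w : T) : \bar R :=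
  \big[maxe/-oo%E]_(j < n.+1) \big[maxe/-oo%E]_(i < j | (h1 <= (j - i)%:R <= h2))
     ((psum X j w - psum X i w) / Num.sqrt (j - i)%:R)%:E.

(* Main.v *)
Require Import Defs.
From HB Require Import structures.
From mathcomp Require Import all_boot all_order all_algebra.
From mathcomp Require Import all_classical all_reals all_analysis.
From mathcomp Require Import measurable_realfun.
From mathcomp Require Import ring lra.
Import Order.TTheory GRing.Theory Num.Theory.
Import numFieldNormedType.Exports.
Import HBNNSimple.
Local Open Scope classical_set_scope.
Local Open Scope ring_scope.

(* Put L = ln n. Single steps already beat B sqrt L for any constant B: since
   alpha < 2, the tail P(X > B sqrt L) exceeds n^(-1/2) for large n, so the
   maximum of n independent copies is at most B sqrt L with probability at most
   (1 - n^(-1/2))^n. Near 0 the moment generating function is bounded by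
   exp(C t^2), so for a block of length k > a L Chernoff's bound with t of order
   sqrt(L/k), which stays in the admissible range precisely because k > a L,
   gives P(S_j - S_i > B sqrt L sqrt k) <= n^(-3) once B is large; a union bound
   over the pairs shows that no long block exceeds B sqrt L. Hence the maximum
   is attained on a block of length at most a L. *)

(** * Factorization of expectations under independence *)

(** The identity on indicators extends to simple functions by linearity and then to [f] by monotone
    convergence. The weight [W] stands for the other factors of a product. *)
Lemma weighted_integral_indep (d : measure_display) (T : measurableType d)
  (R : realType) (P : probability T R) (X : {RV P >-> R}) (W : T -> R)
  (c : \bar R) (mW : measurable_fun [set: T] W) (W0 : forall x, 0 <= W x)
  (c0 : (0 <= c)%E) (cfin : c \is a fin_num) :
  (forall B, measurable B ->
     \int[P]_x (W x * \1_B (X x))%:E = c * P (X @^-1` B))%E ->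
  forall f : R -> R, measurable_fun [set: R] f -> (forall y, 0 <= f y) ->
  (\int[P]_x (W x * f (X x))%:E = c * \int[P]_x (f (X x))%:E)%E.
Proof.
move=> Windic f mf f0.
have mEf : measurable_fun [set: R] (EFin \o f) by exact/measurable_EFinP.
have Ef0 x : [set: R] x -> (0 <= (EFin \o f) x)%E by rewrite lee_fin.
pose g := nnsfun_approx measurableT mEf.
have g0 n y : 0 <= g n y by exact: fun_ge0.
have mX : measurable_fun [set: T] X by exact: measurable_funPT.
have mg n : measurable_fun [set: T] (fun x => g n (X x)).
  by apply: measurableT_comp.
have nd m n y : (m <= n)%N -> g m y <= g n y.
  by move=> mn; exact: (lefP _ _ (nd_nnsfun_approx measurableT mEf mn) y).
have cvg_gf y : ((g n y)%:E @[n --> \oo] --> (f y)%:E)%E.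
  exact: (cvg_nnsfun_approx measurableT mEf Ef0).
have gE n : (\int[P]_x (W x * g n (X x))%:E = c * \int[P]_x (g n (X x))%:E)%E.
  pose I y x : R := \1_(g n @^-1` [set y]) (X x).
  have mB y : measurable (g n @^-1` [set y]) by exact: measurable_sfunP.
  have mI y : measurable_fun [set: T] (I y) by apply: measurableT_comp.
  (* The absolute value keeps every summand nonnegative, whether or not y is a
     value of g n. *)
  have gX x : g n (X x) = \sum_(y \in range (g n)) `|y| * I y x.
    rewrite {1}fimfunE; apply: eq_fsbigr => y /[!inE] -[z _ <-].
    by rewrite ger0_norm.
  transitivity (\int[P]_x
      (\sum_(y \in range (g n)) `|y|%:E * (W x * I y x)%:E))%E.
    apply: eq_integral => x _; rewrite gX mulr_fsumr -fsumEFin//.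
    by apply: eq_fsbigr => y _; rewrite -EFinM mulrCA.
  rewrite ge0_integral_fsum//; last 2 first.
  - by move=> y; apply/measurable_EFinP; do 2 apply: measurable_funM => //.
  - by move=> y x _; rewrite lee_fin !mulr_ge0.
  transitivity (c * \sum_(y \in range (g n))
      \int[P]_x (`|y|%:E * (I y x)%:E))%E; last first.
    congr (_ * _)%E; rewrite -ge0_integral_fsum//; last 2 first.
    - by move=> y; apply/measurable_EFinP; apply: measurable_funM.
    - by move=> y x _; rewrite lee_fin mulr_ge0.
    by apply: eq_integral => x _; rewrite fsumEFin// -gX.
  rewrite ge0_mule_fsumr; last first.
    by move=> y; apply: integral_ge0 => x _; rewrite lee_fin mulr_ge0.
  apply: eq_fsbigr => y _.
  rewrite ge0_integralZl_EFin//; last 2 first.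
  - by move=> x _; rewrite lee_fin mulr_ge0.
  - by apply/measurable_EFinP; apply: measurable_funM.
  rewrite ge0_integralZl_EFin//; last 2 first.
  - by move=> x _; rewrite lee_fin.
  - by apply/measurable_EFinP.
  have -> := Windic _ (mB y); rewrite muleCA; congr (_ * (_ * _))%E.
  transitivity (\int[P]_x (\1_(X @^-1` (g n @^-1` [set y])) x)%:E)%E => //.
  rewrite integral_indic ?setIT//.
  by rewrite -[X in measurable X]setTI; apply: mX.
(* Monotone convergence passes from [g n] to [f] on both sides; by [gE] the two sequences agree up
   to the factor [c], so their limits do too. *)
have cvgl : ((\int[P]_x (W x * g n (X x))%:E)%E @[n --> \oo] -->
    (\int[P]_x (W x * f (X x))%:E)%E).
  rewrite [X in _ --> X](_ : _ =
      \int[P]_x limn (fun n => (W x * g n (X x))%:E))%E.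
    apply: cvg_monotone_convergence => //.
    - by move=> n; apply/measurable_EFinP; apply: measurable_funM.
    - by move=> n x _; rewrite lee_fin mulr_ge0.
    - by move=> x _ m n mn; rewrite lee_fin ler_wpM2l// nd.
  apply: eq_integral => x _; apply/esym/cvg_lim => //.
  under eq_fun do rewrite EFinM.
  by rewrite EFinM; apply: cvgeZl.
have cvgr : ((\int[P]_x (g n (X x))%:E)%E @[n --> \oo] -->
    (\int[P]_x (f (X x))%:E)%E).
  rewrite [X in _ --> X](_ : _ = \int[P]_x limn (fun n => (g n (X x))%:E))%E.
    apply: cvg_monotone_convergence => //.
    - by move=> n; apply/measurable_EFinP.
    - by move=> n x _; rewrite lee_fin.
    - by move=> x _ m n mn; rewrite lee_fin nd.
  by apply: eq_integral => x _; apply/esym/cvg_lim.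
apply: (cvg_unique _ cvgl) => //.
rewrite (_ : (fun n => _) = (fun n => c * \int[P]_x (g n (X x))%:E)%E).
  exact: cvgeZl.
exact/funext.
Qed.

(* Induction on J, turning one indicator at a time into f j (X j); the set
   K of remaining indicators is what makes the hypothesis strong enough. *)
Lemma expectation_prod_indep (d : measure_display) (T : measurableType d)
  (R : realType) (P : probability T R) (X : nat -> {RV P >-> R})
  (f : nat -> R -> R) :
  mutually_independent P (fun k => (X k : T -> R)) ->
  (forall i, measurable_fun [set: R] (f i)) -> (forall i y, 0 <= f i y) ->
  (forall i, (\int[P]_x (f i (X i x))%:E)%E \is a fin_num) ->
  forall (J K : seq nat) (B : nat -> set R), uniq (J ++ K) ->
  (forall i, measurable (B i)) ->
  (\int[P]_x (\prod_(j <- J) f j (X j x) * \prod_(k <- K) \1_(B k) (X k x))%:E =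
   (\prod_(j <- J) \int[P]_x (f j (X j x))%:E) *
   \prod_(k <- K) P (X k @^-1` B k))%E.
Proof.
move=> indep mf f0 ffin J.
have mX i : measurable_fun [set: T] (X i) by exact: measurable_funPT.
have f0' i : (0 <= \int[P]_x (f i (X i x))%:E)%E.
  by apply: integral_ge0 => x _; rewrite lee_fin.
have mXB B i : measurable B -> measurable (X i @^-1` B).
  by move=> mB; rewrite -[X in measurable X]setTI; exact: mX.
elim: J => [|j J IHJ] K B.
  move=> uK mB; rewrite big_nil mul1e -indep//.
  (* With [J] empty the integrand is the indicator of the intersection of preimages, the event that
     [mutually_independent] speaks of. *)
  transitivity (\int[P]_x
      (\1_(\bigcap_(i in [set` K]) (X i @^-1` B i)) x)%:E)%E.
    apply: eq_integral => x _; rewrite big_nil mul1r; congr (_%:E).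
    rewrite bigcap_seq; elim: K {uK} => [|k K IHK].
      by rewrite !big_nil indicT.
    by rewrite !big_cons IHK indicI.
  rewrite integral_indic ?setIT//.
  rewrite bigcap_seq.
  by apply: bigsetI_measurable => i _; apply: mXB.
rewrite cat_cons => /andP[]; rewrite mem_cat negb_or => /andP[jJ jK] uJK mB.
pose W x := \prod_(j <- J) f j (X j x) * \prod_(k <- K) \1_(B k) (X k x).
pose c := ((\prod_(j <- J) \int[P]_x (f j (X j x))%:E) *
   \prod_(k <- K) P (X k @^-1` B k))%E.
transitivity (\int[P]_x (W x * f j (X j x))%:E)%E.
  by apply: eq_integral => x _; rewrite big_cons /W; congr (_%:E); ring.
rewrite (weighted_integral_indep _ _ _ _ _ _ c)//.
- by rewrite big_cons muleC -muleA.
- apply: measurable_funM; apply: measurable_prod => i _ /=.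
    exact: measurableT_comp.
  by apply: measurableT_comp.
- by move=> x; rewrite mulr_ge0// prodr_ge0.
- by apply: mule_ge0; elim/big_ind: _ => // *; exact: mule_ge0.
- rewrite fin_numM//; elim/big_ind: _ => //; first exact: fin_numM.
  + exact: fin_numM.
  + by move=> k _; rewrite fin_num_measure//; exact: mXB.
move=> A mA.
(* Trading [f j] for the indicator of [A] moves [j] into the list of indicators. As [j] is not in
   [K], redefining [B] at [j] changes no other factor, and the induction hypothesis applies to
   [j :: K]. *)
pose B' i := if i == j then A else B i.
have B'K k : k \in K -> B' k = B k.
  by rewrite /B'; case: eqP => // -> kK; rewrite kK in jK.
have uJjK : uniq (J ++ [:: j] ++ K).
  by rewrite uniq_catCA /= mem_cat negb_or jJ jK.
have mB' i : measurable (B' i) by rewrite /B'; case: ifP.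
have B'j : B' j = A by rewrite /B' eqxx.
have KP : (\prod_(k <- K) P (X k @^-1` B' k) = \prod_(k <- K) P (X k @^-1` B k))%E.
  by apply: eq_big_seq => k /B'K ->.
have KI x : \prod_(k <- K) \1_(B' k) (X k x) =
    \prod_(k <- K) \1_(B k) (X k x) :> R.
  by apply: eq_big_seq => k /B'K ->.
have := IHJ (j :: K) B' uJjK mB'.
rewrite big_cons KP B'j muleCA muleC => <-.
apply: eq_integral => x _; rewrite big_cons KI B'j /W.
by congr (_%:E); ring.
Qed.

(** * Quadratic control of the moment generating function near 0 *)

(** Put y = t x. For x >= 0, (1 - y) e^y <= 1 yields e^y <= 1 + y + y^2 e^y, and x^2 <= (2/s^2) e^(s
    x) absorbs the square into an exponential whose rate 2s is free of t. For x < 0 the term y^2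
    alone suffices. *)
Lemma expR_le_quadratic (R : realType) (s t x : R) : 0 < s -> 0 <= t <= s ->
  expR (t * x) <=
  1 + t * x + (t ^+ 2 * x ^+ 2 + t ^+ 2 * (2 / s ^+ 2) * expR (2 * s * x)).
Proof.
move=> s0 /andP[t0 ts].
have K0 : 0 <= 2 / s ^+ 2 by rewrite divr_ge0// exprn_ge0// ltW.
have E0 : 0 <= t ^+ 2 * (2 / s ^+ 2) * expR (2 * s * x).
  by rewrite mulr_ge0 ?expR_ge0// mulr_ge0// exprn_ge0.
have [x0|x0] := leP 0 x.
  have y0 : 0 <= t * x by rewrite mulr_ge0.
  have h1 : expR (t * x) <= 1 + t * x + (t * x) ^+ 2 * expR (t * x).
    have := expR_ge1Dx (- (t * x)); rewrite expRN => h.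
    have e0 := expR_gt0 (t * x).
    have {}h : (1 - t * x) * expR (t * x) <= 1.
      by rewrite -ler_pdivlMr// div1r.
    nra.
  have h2 : x ^+ 2 <= 2 / s ^+ 2 * expR (s * x).
    have := expR_ge1Dxn 1 (mulr_ge0 (ltW s0) x0).
    rewrite exprMn => h.
    rewrite mulrAC ler_pdivlMr ?exprn_gt0//.
    rewrite (_ : 2`!%:R = 2 :> R)// in h; lra.
  have h3 : expR (t * x) <= expR (s * x) by rewrite ler_expR ler_wpM2r.
  have h4 : x ^+ 2 * expR (t * x) <= 2 / s ^+ 2 * expR (2 * s * x).
    have -> : 2 * s * x = s * x + s * x by ring.
    rewrite expRD mulrA; by apply: ler_pM => //; exact: sqr_ge0.
  have h5 := ler_wpM2l (sqr_ge0 t) h4.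
  have h6 := mulr_ge0 (sqr_ge0 t) (sqr_ge0 x).
  by apply: (le_trans h1); rewrite lerD2l exprMn; lra.
have y0 : 0 <= - (t * x) by rewrite -mulrN mulr_ge0// oppr_ge0 ltW.
have h1 : expR (t * x) <= 1 + t * x + (t * x) ^+ 2.
  have := expR_ge1Dx (- (t * x)); rewrite expRN => h.
  have e0 := expR_gt0 (t * x).
  have {}h : (1 - t * x) * expR (t * x) <= 1.
    by rewrite -ler_pdivlMr// div1r.
  have c0 : 0 <= (- (t * x)) ^+ 3 by rewrite exprn_ge0.
  (* For y = t x <= 0, (1 - y)(1 + y + y^2) = 1 - y^3 >= 1 >= (1 - y) e^y. *)
  rewrite -(@ler_pM2l _ (1 - t * x)); last by lra.
  nra.
by apply: (le_trans h1); rewrite addrA exprMn lerDl.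
Qed.

(** Integrate the pointwise bound: mean zero removes the linear term, the second moment is 1, and E
    e^(2sX) is a constant, which leaves 1 + C t^2 <= e^(C t^2). *)
Lemma mgf_subgaussian_near0 (d : measure_display) (T : measurableType d)
  (R : realType) (P : probability T R) (X : {RV P >-> R}) (t0 : R) :
  P.-integrable setT (EFin \o X) -> 'E_P[X]%E = 0%E -> 'V_P[X]%E = 1%E ->
  0 < t0 ->
  (forall t : R, 0 <= t < t0 ->
     (expectation P (fun w => expR (t * X w)%R) < +oo)%E) ->
  exists C s : R, [/\ 0 <= C, 0 < s & forall t, 0 <= t <= s ->
    (\int[P]_w (expR (t * X w))%:E <= (expR (C * t ^+ 2))%:E)%E].
Proof.
move=> iX EX VX t0_gt0 mgf.
have mX : measurable_fun [set: T] X by exact: measurable_funPT.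
have mE t : measurable_fun [set: T] (fun w => expR (t * X w)).
  by apply: measurableT_comp => //; exact: measurable_funM.
have iE t : 0 <= t < t0 ->
    P.-integrable [set: T] (fun w => (expR (t * X w))%:E).
  move=> tt0; apply/integrableP; split; first exact/measurable_EFinP.
  under eq_integral do rewrite gee0_abs ?lee_fin ?expR_ge0//.
  by have := mgf t tt0; rewrite unlock.
have EX0 : (\int[P]_w (X w)%:E = 0)%E by rewrite -EX unlock.
have EX2 : (\int[P]_w (X w ^+ 2)%:E = 1)%E.
  rewrite -VX /variance unlock EX unlock; apply: eq_integral => w _ /=.
  by rewrite !fctE/= subr0 expr2.
have iX2 : P.-integrable [set: T] (fun w => (X w ^+ 2)%:E).
  apply/integrableP; split.
    by apply/measurable_EFinP; exact: measurable_funX.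
  under eq_integral do rewrite gee0_abs ?lee_fin ?sqr_ge0//.
  by rewrite EX2 ltry.
have I1 : (\int[P]_w 1%:E = 1)%E.
  by rewrite integral_cst//= mul1e probability_setT.
have i1 : P.-integrable [set: T] (fun=> 1%:E).
  apply/integrableP; split; first exact: measurable_cst.
  under eq_integral do rewrite gee0_abs ?lee_fin//.
  by rewrite I1 ltry.
(* With this choice 2s = t0/2 stays inside the interval where exponential moments are finite. *)
pose s := t0 / 4.
have s0 : 0 < s by rewrite divr_gt0.
have s2 : 0 <= 2 * s < t0 by rewrite /s; apply/andP; split; lra.
pose m := fine (\int[P]_w (expR (2 * s * X w))%:E)%E.
have mdef : (\int[P]_w (expR (2 * s * X w))%:E = m%:E)%E.
  by rewrite fineK// integrable_fin_num//; exact: iE.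
have m0 : 0 <= m.
  by apply: fine_ge0; apply: integral_ge0 => w _; rewrite lee_fin expR_ge0.
pose K := 2 / s ^+ 2.
have K0 : 0 <= K by rewrite divr_ge0// exprn_ge0// ltW.
exists (1 + K * m), s; split => //; first by rewrite addr_ge0// mulr_ge0.
move=> t tts; have [t_ge0 ts] := andP tts.
pose g w := ((1%:E + t%:E * (X w)%:E) + ((t ^+ 2)%:E * (X w ^+ 2)%:E +
   (t ^+ 2 * K)%:E * (expR (2 * s * X w))%:E))%E.
have ia : P.-integrable [set: T] (fun w => 1%:E + t%:E * (X w)%:E)%E.
  by apply: integrableD => //; exact: integrableZl.
have ib : P.-integrable [set: T] (fun w => (t ^+ 2)%:E * (X w ^+ 2)%:E +
   (t ^+ 2 * K)%:E * (expR (2 * s * X w))%:E)%E.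
  by apply: integrableD => //; apply: integrableZl => //; exact: iE.
apply: (@le_trans _ _ (\int[P]_w g w)%E).
  apply: le_integral => //.
  - by apply: iE; rewrite t_ge0; apply: (le_lt_trans ts); rewrite /s; lra.
  - exact: integrableD.
  - by move=> w _; rewrite /g -!EFinM -!EFinD lee_fin expR_le_quadratic.
rewrite /g integralD// integralD//; last exact: integrableZl.
rewrite integralD//; last 2 first.
- exact: integrableZl.
- by apply: integrableZl => //; exact: iE.
rewrite !integralZl//; last exact: iE.
rewrite EX0 EX2 mdef I1 !mule1 mule0 adde0.
rewrite -EFinM -!EFinD lee_fin; apply: le_trans (expR_ge1Dx _).
by rewrite lerD2l; lra.
Qed.

(** * Tail estimates for blocks and for single steps *)

Lemma integral_comp_ident (d : measure_display) (T : measurableType d)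
  (R : realType) (P : probability T R) (X : nat -> {RV P >-> R}) (i : nat)
  (f : R -> R) :
  identically_distributed P (fun k => (X k : T -> R)) ->
  measurable_fun [set: R] f -> (forall y, 0 <= f y) ->
  (\int[P]_x (f (X i x))%:E = \int[P]_x (f (X 0%N x))%:E)%E.
Proof.
move=> ident mf f0.
have mX k : measurable_fun [set: T] (X k) by exact: measurable_funPT.
have push k : (\int[P]_x (f (X k x))%:E =
    \int[pushforward P (X k)]_y (f y)%:E)%E.
  rewrite ge0_integral_pushforward ?preimage_setT//.
    exact/measurable_EFinP.
  by move=> y _; rewrite lee_fin.
rewrite !push; apply: eq_measure_integral => A mA _.
exact: ident.
Qed.

Lemma psumB (T : Type) (R : realType) (X : nat -> T -> R) (i j : nat) w :
  (i <= j)%N -> psum X j w - psum X i w = \sum_(i <= k < j) X k w.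
Proof.
move=> ij; rewrite /psum -!(big_mkord xpredT (fun k => X k w)).
by rewrite [X in X - _](big_cat_nat (n := i))//= [X in X - _]addrC addrK.
Qed.

(** Chernoff's bound: Markov's inequality for e^(tS), whose expectation factors into j - i terms,
    each at most e^b. *)
Lemma psumB_tail (d : measure_display) (T : measurableType d)
  (R : realType) (P : probability T R) (X : nat -> {RV P >-> R})
  (b t y : R) (i j : nat) :
  mutually_independent P (fun k => (X k : T -> R)) ->
  identically_distributed P (fun k => (X k : T -> R)) ->
  (\int[P]_w (expR (t * X 0%N w))%:E <= (expR b)%:E)%E ->
  0 <= t -> (i <= j)%N ->
  (P [set w | (y < psum (fun k => (X k : T -> R)) j w -
                   psum (fun k => (X k : T -> R)) i w)%R] <=
   (expR ((j - i)%:R * b - t * y))%:E)%E.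
Proof.
move=> indep ident Xb t0 ij.
have mX k : measurable_fun [set: T] (X k) by exact: measurable_funPT.
pose f (_ : nat) (x : R) := expR (t * x).
have mf k : measurable_fun [set: R] (f k).
  by apply: measurableT_comp => //; exact: measurable_funM.
have f0 k x : 0 <= f k x by exact: expR_ge0.
have fb k : (\int[P]_w (f k (X k w))%:E <= (expR b)%:E)%E.
  rewrite (@integral_comp_ident _ _ _ _ _ _ (f k))//; exact: mf.
have If0 k : (0 <= \int[P]_w (f k (X k w))%:E)%E.
  by apply: integral_ge0 => w _; rewrite lee_fin.
have ffin k : (\int[P]_w (f k (X k w))%:E)%E \is a fin_num.
  by rewrite ge0_fin_numE//; apply: (le_lt_trans (fb k)); rewrite ltry.
pose S w := \sum_(i <= k < j) X k w.
have mS : measurable_fun [set: T] S by exact: measurable_sum.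
have -> : [set w | y < psum (fun k => (X k : T -> R)) j w -
    psum (fun k => (X k : T -> R)) i w] = [set w | y < S w].
  by apply/seteqP; split => w /=; rewrite psumB.
have mA : measurable [set w | y < S w].
  rewrite (_ : [set w | y < S w] = S @^-1` `]y, +oo[%classic); last first.
    by apply/seteqP; split => w /=; rewrite in_itv/= andbT.
  by rewrite -[X in measurable X]setTI; exact: mS.
have EprodE : (\int[P]_w (expR (t * S w))%:E =
    \prod_(k <- index_iota i j) \int[P]_w (f k (X k w))%:E)%E.
  (* The list of indicators is empty here, so [fun=> setT] is only a filler. *)
  have := @expectation_prod_indep _ _ _ _ _ _ indep mf f0 ffin
    (index_iota i j) [::] (fun=> setT).
  rewrite cats0 iota_uniq big_nil mule1 => <-//.
  apply: eq_integral => w _; rewrite big_nil mulr1 /S; congr (_%:E).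
  elim/big_rec2: _ => [|k u v _ <-]; first by rewrite mulr0 expR0.
  by rewrite mulrDr expRD.
have Ebound : (\int[P]_w (expR (t * S w))%:E <= (expR ((j - i)%:R * b))%:E)%E.
  rewrite EprodE -(size_iota i (j - i)) /index_iota.
  elim: (iota _ _) => [|k s IHs]; first by rewrite big_nil /= mul0r expR0.
  rewrite big_cons /= -natr1 mulrDl mul1r addrC expRD EFinM lee_pmul//.
  by elim/big_ind: _ => // *; exact: mule_ge0.
have mES : measurable_fun [set: T] (fun w => expR (t * S w)).
  by apply: measurableT_comp => //; exact: measurable_funM.
rewrite addrC expRD EFinM.
apply: (@le_trans _ _ ((expR (- (t * y)))%:E *
    \int[P]_w (expR (t * S w))%:E)%E); last first.
  by apply: lee_wpmul2l => //; rewrite lee_fin expR_ge0.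
rewrite -ge0_integralZl_EFin ?expR_ge0//; last first.
  by apply/measurable_EFinP.
rewrite -[X in P X]setIT -integral_indic//.
apply: ge0_le_integral => //.
- by apply/measurable_EFinP.
- by apply/measurable_EFinP; exact: measurable_funM.
(* Markov's inequality pointwise: e^(t(S - y)) is at least 1 where S > y and nonnegative
   elsewhere. *)
move=> w _; rewrite -EFinM lee_fin -expRD indicE.
case: (boolP (w \in _)) => [|_]; last exact: expR_ge0.
rewrite inE /= => yS; rewrite -[leLHS]expR0 ler_expR addrC subr_ge0.
by rewrite ler_wpM2l// ltW.
Qed.

(** The events X_i <= v are independent, and each has probability at most 1 - p <= e^(-p). *)
Lemma prob_all_le (d : measure_display) (T : measurableType d)
  (R : realType) (P : probability T R) (X : nat -> {RV P >-> R})
  (v p : R) (n : nat) :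
  mutually_independent P (fun k => (X k : T -> R)) ->
  identically_distributed P (fun k => (X k : T -> R)) ->
  (p%:E <= P [set w | (v < X 0%N w)%R])%E ->
  (P (\bigcap_(i in [set` iota 0 n]) (X i @^-1` `]-oo, v]%classic)) <=
   (expR (- (n%:R * p)))%:E)%E.
Proof.
move=> indep ident pv.
have mX k : measurable_fun [set: T] (X k) by exact: measurable_funPT.
have mI : measurable (X 0%N @^-1` `]-oo, v]%classic).
  by rewrite -[X in measurable X]setTI; exact: mX.
rewrite (indep _ (fun=> `]-oo, v]%classic)) ?iota_uniq//.
have le1 k : (P (X k @^-1` `]-oo, v]%classic) <= (expR (- p))%:E)%E.
  rewrite ident// -[X in P X]setCK probability_setC; last exact: measurableC.
  rewrite (_ : ~` _ = [set w | v < X 0%N w]); last first.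
    by apply/seteqP; split => w /=; rewrite in_itv/= ltNge => /negP.
  apply: (@le_trans _ _ (1 - p%:E)%E); first exact: leeB.
  by rewrite -EFinB lee_fin expR_ge1Dx.
rewrite -[in leRHS](size_iota 0 n).
elim: (iota _ _) => [|k s IHs]; first by rewrite big_nil /= mul0r oppr0 expR0.
rewrite big_cons /= -natr1 mulrDl mul1r opprD addrC expRD EFinM lee_pmul//.
by elim/big_ind: _ => // *; exact: mule_ge0.
Qed.

(** * Comparison of the full and the restricted maximum *)

(** A deterministic criterion: the step [i0] is a block of length 1, admissible because [1 <= h],
    and its ratio is at least [v], while every block longer than [h] has ratio at most [v].
    Discarding the long blocks therefore loses nothing. *)
Lemma Mmax_eq_restr (T : Type) (R : realType) (X : nat -> T -> R) (v h : R)
  (n i0 : nat) (w : T) :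
  1 <= h -> (i0 < n)%N -> v <= X i0 w ->
  (forall i j, (i < j <= n)%N -> h < (j - i)%:R ->
     psum X j w - psum X i w <= v * Num.sqrt (j - i)%:R) ->
  Mmax X n w = Mmax_restr X 1 h n w.
Proof.
move=> h1 i0n vX long.
pose r j i := ((psum X j w - psum X i w) / Num.sqrt (j - i)%:R)%:E.
(* The predicate [Q] serves both maxima: constantly true for the full one, the length condition for
   the restricted one. *)
have le_inner (Q : nat -> nat -> bool) (j i : nat) : (j < n.+1)%N -> (i < j)%N ->
    Q j i -> (r j i <= \big[maxe/-oo]_(j < n.+1) \big[maxe/-oo]_(i < j | Q j i)
      r j i)%E.
  move=> jn ij Qji.
  pose F j := \big[maxe/-oo%E]_(i < j | Q j i) r j i.
  apply: (@le_trans _ _ (F j)).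
    exact: (le_bigmax_cond _ (fun i : 'I_j => r j i) (j := Ordinal ij)).
  exact: (le_bigmax_cond _ (fun j : 'I_n.+1 => F j) (j := Ordinal jn)).
apply/eqP; rewrite eq_le; apply/andP; split.
  apply: bigmax_le; first exact: leNye.
  move=> j _; apply: bigmax_le; first exact: leNye.
  move=> i _.
  have ij : (i < j)%N by exact: ltn_ord.
  have [jih|jih] := leP ((j - i)%:R : R) h.
    apply: (le_inner (fun j i => 1 <= (j - i)%:R <= h)) => //.
    by rewrite jih andbT ler1n subn_gt0.
  (* A long pair is dominated by the single step [i0]. *)
  apply: (@le_trans _ _ (r i0.+1 i0)).
    rewrite lee_fin [leRHS](_ : _ = X i0 w); last first.
      by rewrite /psum big_ord_recr/= [X in X - _]addrC addrK subSnn sqrtr1 divr1.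
    apply: le_trans vX; rewrite ler_pdivrMr.
      by apply: long => //; rewrite ij -ltnS ltn_ord.
    by rewrite sqrtr_gt0 ltr0n subn_gt0.
  apply: (le_inner (fun j i => 1 <= (j - i)%:R <= h)) => //.
  by rewrite subSnn lexx.
apply: bigmax_le; first exact: leNye.
move=> j _; apply: bigmax_le; first exact: leNye.
by move=> i _; exact: (le_inner (fun _ _ => true)).
Qed.

Lemma measurable_bigmaxe (d : measure_display) (T : measurableType d)
  (R : realType) (I : Type) (r : seq I) (Q : pred I) (F : I -> T -> \bar R) :
  (forall i, measurable_fun [set: T] (F i)) ->
  measurable_fun [set: T] (fun w => \big[maxe/-oo%E]_(i <- r | Q i) F i w).
Proof.
move=> mF; elim: r => [|i r IHr].
  by under eq_fun do rewrite big_nil; exact: measurable_cst.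
under eq_fun do rewrite big_cons.
by case: (Q i) => //; exact: measurable_maxe.
Qed.

Lemma measurable_Mmax_eq_restr (d : measure_display) (T : measurableType d)
  (R : realType) (X : nat -> T -> R) (h1 h2 : R) (n : nat) :
  (forall k, measurable_fun [set: T] (X k)) ->
  measurable [set w | Mmax X n w = Mmax_restr X h1 h2 n w].
Proof.
move=> mX; rewrite -[X in measurable X]setTI.
have mS k : measurable_fun [set: T] (psum X k) by exact: measurable_sum.
have mratio i j : measurable_fun [set: T]
    (fun w => ((psum X j w - psum X i w) / Num.sqrt (j - i)%:R)%:E).
  apply/measurable_EFinP; apply: measurable_funM => //.
  exact: measurable_funB.
by apply: measurable_eqe => //; apply: measurable_bigmaxe => j;
  apply: measurable_bigmaxe => i; exact: mratio.
Qed.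

(** * Growth estimates in terms of ln n *)

Lemma near_ge_ln (R : realType) (M : R) : \forall n \near \oo, M <= ln n%:R.
Proof.
near=> n; have nM : expR M <= n%:R by near: n; exact: nbhs_infty_ger.
rewrite -[leLHS]expRK ler_ln// posrE ?expR_gt0//.
exact: lt_le_trans (expR_gt0 _) nM.
Unshelve. all: by end_near. Qed.

(* For z = B sqrt L one has z^alpha = z^2 / z^(2 - alpha) and z^2 = B^2 L. *)
Lemma powR_sqrt_le_half (R : realType) (alpha B : R) : alpha < 2 -> 0 < B ->
  exists M : R, forall L, M <= L -> 0 < L ->
    (B * Num.sqrt L) `^ alpha <= L / 2.
Proof.
move=> alpha2 B0.
(* Chosen so that z0^(2 - alpha) = 2 B^2; the threshold (z0/B)^2 for L then forces B sqrt L >=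
   z0. *)
pose z0 := (2 * B ^+ 2) `^ (2 - alpha)^-1.
exists ((z0 / B) ^+ 2) => L ML L0.
pose z := B * Num.sqrt L.
have B2 : 0 < B ^+ 2 by rewrite exprn_gt0.
have z_gt0 : 0 < z by rewrite mulr_gt0// sqrtr_gt0.
have z0_ge0 : 0 <= z0 by exact: powR_ge0.
have z0z : z0 <= z.
  rewrite /z mulrC -ler_pdivrMr// -[leLHS]ger0_norm; last first.
    by rewrite divr_ge0// ltW.
  by rewrite -sqrtr_sqr ler_wsqrtr.
have a2 : 0 < 2 - alpha by rewrite subr_gt0.
have h : 2 * B ^+ 2 <= z `^ (2 - alpha).
  apply: (@le_trans _ _ (z0 `^ (2 - alpha))); last first.
    by apply: ge0_ler_powR; rewrite ?nnegrE//; exact: ltW.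
  by rewrite /z0 -powRrM mulVf ?gt_eqF// powRr1// mulr_ge0// ltW.
have zz : z `^ alpha * z `^ (2 - alpha) = B ^+ 2 * L.
  rewrite -powRD; last by rewrite (gt_eqF z_gt0) implybT.
  rewrite addrC subrK -[X in z `^ X]/(2%:R) powR_mulrn ?ltW//.
  by rewrite /z exprMn sqr_sqrtr// ltW.
rewrite -/z ler_pdivlMr// -(@ler_pM2r _ (B ^+ 2))// [leRHS]mulrC -zz -mulrA.
by rewrite ler_wpM2l// powR_ge0.
Qed.

(** * Probability that some long block is too large *)

Definition long_exceed {T : Type} {R : realType} (X : nat -> T -> R) (h v : R)
    (j i : nat) : set T :=
  [set w | [&& (i < j)%N, h < (j - i)%:R &
     v * Num.sqrt (j - i)%:R < psum X j w - psum X i w]].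

Lemma long_exceedE (T : Type) (R : realType) (X : nat -> T -> R) (h v : R)
    (j i : nat) :
  long_exceed X h v j i = if (i < j)%N && (h < (j - i)%:R) then
    [set w | v * Num.sqrt (j - i)%:R < psum X j w - psum X i w] else set0.
Proof.
rewrite /long_exceed; case: ifP => [/andP[-> ->]//|c].
by apply/seteqP; split => w //= /and3P[h1 h2 _]; rewrite h1 h2 in c.
Qed.

Lemma measurable_long_exceed (d : measure_display) (T : measurableType d)
  (R : realType) (X : nat -> T -> R) (h v : R) (j i : nat) :
  (forall k, measurable_fun [set: T] (X k)) ->
  measurable (long_exceed X h v j i).
Proof.
move=> mX; rewrite long_exceedE; case: ifP => // _; set y := _ * Num.sqrt _.
have mS k : measurable_fun [set: T] (psum X k) by exact: measurable_sum.
rewrite (_ : [set w | _] = (psum X j \- psum X i) @^-1` `]y, +oo[%classic).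
  by rewrite -[X in measurable X]setTI; apply: measurable_funB.
by apply/seteqP; split => w /=; rewrite in_itv/= andbT.
Qed.

(** Chernoff's bound gives e^(-3L) for each pair, whatever its length, and Boole's inequality is
    applied to the (n+1)^2 pairs. *)
Lemma prob_long_exceed (d : measure_display) (T : measurableType d)
  (R : realType) (P : probability T R) (X : nat -> {RV P >-> R})
  (C s a L B : R) (n : nat) :
  mutually_independent P (fun k => (X k : T -> R)) ->
  identically_distributed P (fun k => (X k : T -> R)) ->
  0 < s -> 0 < a -> 0 < L ->
  (forall t, 0 <= t <= s ->
    (\int[P]_w (expR (t * X 0%N w))%:E <= (expR (C * t ^+ 2))%:E)%E) ->
  B = (3 + C * s ^+ 2 * a) / (s * Num.sqrt a) ->
  (P (\big[setU/set0]_(j < n.+1) \big[setU/set0]_(i < n.+1)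
      long_exceed (fun k => (X k : T -> R)) (a * L) (B * Num.sqrt L) j i) <=
   (n.+1%:R ^+ 2 * expR (- (3 * L)))%:E)%E.
Proof.
move=> indep ident s0 a0 L0 mgf Bdef.
have mX k : measurable_fun [set: T] (X k) by exact: measurable_funPT.
pose A := long_exceed (fun k => (X k : T -> R)) (a * L) (B * Num.sqrt L).
have mA j i : measurable (A j i) by exact: measurable_long_exceed.
have PA j i : (P (A j i) <= (expR (- (3 * L)))%:E)%E.
  rewrite /A long_exceedE; case: ifP => [/andP[ij aLk]|_]; last first.
    by rewrite measure0 lee_fin expR_ge0.
  set k : R := (j - i)%:R in aLk *.
  have k0 : 0 < k by rewrite ltr0n subn_gt0.
  have aL0 : 0 <= a * L by rewrite mulr_ge0// ltW.
  (* This makes k t^2 = s^2 a L independent of the length k, and k > a L keeps t below s. *)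
  pose t := s * Num.sqrt (a * L / k).
  have aLk0 : 0 <= a * L / k by rewrite divr_ge0// ltW.
  have t2 : t ^+ 2 = s ^+ 2 * (a * L / k) by rewrite exprMn sqr_sqrtr.
  have ts : 0 <= t <= s.
    apply/andP; split; first by rewrite mulr_ge0// ?sqrtr_ge0// ltW.
    rewrite -[leRHS]mulr1 ler_pM2l// -sqrtr1 ler_wsqrtr//.
    by rewrite ler_pdivrMr// mul1r ltW.
  have [t_ge0 _] := andP ts.
  apply: le_trans (@psumB_tail _ _ _ P X _ t _ i j indep ident (mgf _ ts)
    t_ge0 (ltnW ij)) _.
  rewrite lee_fin ler_expR.
  have -> : t * (B * Num.sqrt L * Num.sqrt k) = (3 + C * s ^+ 2 * a) * L.
    have -> : t = s * Num.sqrt a * Num.sqrt L / Num.sqrt k.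
      by rewrite /t sqrtrM// sqrtrM ?ltW// sqrtrV ?ltW// !mulrA.
    rewrite Bdef -[X in _ = _ * X](sqr_sqrtr (ltW L0)).
    have sa : Num.sqrt a != 0 by rewrite gt_eqF// sqrtr_gt0.
    have sk : Num.sqrt k != 0 by rewrite gt_eqF// sqrtr_gt0.
    have s1 : s != 0 by rewrite gt_eqF.
    by field; rewrite s1 sa sk.
  have -> : (j - i)%:R * (C * t ^+ 2) = C * s ^+ 2 * a * L.
    rewrite -/k t2; have k1 : k != 0 by rewrite gt_eqF.
    by field.
  lra.
apply: (@le_trans _ _ (\sum_(j < n.+1) \sum_(i < n.+1) (expR (- (3 * L)))%:E)%E).
  apply: le_trans (@Boole_inequality _ _ _ P
    (fun j => \big[setU/set0]_(i < n.+1) A j i) n.+1 _) _.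
    by move=> j _; apply: bigsetU_measurable.
  apply: lee_sum => j _.
  apply: le_trans (@Boole_inequality _ _ _ P (A j) n.+1 _) _ => //.
  by apply: lee_sum => i _; exact: PA.
under eq_bigr do rewrite sumEFin.
set c := expR _; rewrite sumEFin !sumr_const !card_ord lee_fin.
by rewrite -[leLHS]mulr_natl -[c *+ _]mulr_natl mulrA -expr2.
Qed.

(** * Convergence of the probability to 1 *)

Theorem theorem1p6 (d : measure_display) (T : measurableType d) (R : realType)
  (P : probability T R) (X : nat -> {RV P >-> R}) :
  mutually_independent P (fun k => (X k : T -> R)) ->
  identically_distributed P (fun k => (X k : T -> R)) ->
  P.-integrable setT (EFin \o (X 0%N : T -> R)) ->
  'E_P[X 0%N]%E = 0%E ->
  'V_P[X 0%N]%E = 1%E ->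
  (exists t0 : R, 0 < t0 /\
     forall t : R, 0 <= t < t0 -> (expectation P (fun w => expR (t * X 0%N w)%R) < +oo)%E) ->
  (exists alpha : R, alpha < 2 /\
     exists x0 : R, forall x : R, x0 < x ->
       ((expR (- (x `^ alpha)))%:E < P [set w | (x < X 0%N w)%R])%E) ->
  forall a : R, 0 < a ->
    (fun n : nat => P [set w | Mmax (fun k => (X k : T -> R)) n w =
                               Mmax_restr (fun k => (X k : T -> R)) 1 (a * ln n%:R) n w])
      @ \oo --> 1%E.
Proof.
move=> indep ident iX EX VX [t0 [t0_gt0 mgf]] [alpha [alpha2 [x0 tail]]] a a0.
have mX k : measurable_fun [set: T] (X k) by exact: measurable_funPT.
have [C [s [C0 s0 mgfb]]] :=
  @mgf_subgaussian_near0 _ _ _ _ _ _ iX EX VX t0_gt0 mgf.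
(* This B makes the exponent k C t^2 - t B sqrt(L k) of the Chernoff bound at
   t = s sqrt(a L / k) equal to -3 L for every length k. *)
pose B := (3 + C * s ^+ 2 * a) / (s * Num.sqrt a).
have B0 : 0 < B.
  rewrite divr_gt0 ?mulr_gt0 ?sqrtr_gt0// ltr_wpDr//.
  by rewrite !mulr_ge0// ?sqr_ge0// ltW.
have [M powM] := @powR_sqrt_le_half _ _ _ alpha2 B0.
pose G n := [set w | Mmax (fun k => (X k : T -> R)) n w =
  Mmax_restr (fun k => (X k : T -> R)) 1 (a * ln n%:R) n w].
have mG n : measurable (G n) by exact: measurable_Mmax_eq_restr.
(* Here e^(-L/2) = n^(-1/2); the 5 is 1 from the single steps plus 4 from the long blocks. *)
have lowerP : \forall n \near \oo,
    ((1 - 5 * expR (- (ln n%:R / 2)))%:E <= P (G n) <= 1)%E.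
  near=> n; apply/andP; split; last exact: probability_le1.
  have n1 : (0 < n)%N by near: n; exact: nbhs_infty_gt.
  (* The four thresholds on L give, in turn, positivity of L, a L >= 1 so that single steps are
     admissible, v^alpha <= L/2, and v > x0. *)
  have L1 : (1 : R) <= ln n%:R by near: n; exact: near_ge_ln.
  have La : a^-1 <= ln n%:R by near: n; exact: near_ge_ln.
  have LM : M <= ln n%:R by near: n; exact: near_ge_ln.
  have Lx : ((`|x0| + 1) / B) ^+ 2 <= ln n%:R by near: n; exact: near_ge_ln.
  move: L1 La LM Lx; set L : R := ln n%:R => L1 La LM Lx.
  pose v := B * Num.sqrt L.
  have L0 : 0 < L by exact: lt_le_trans L1.
  have nL : n%:R = expR L by rewrite lnK// posrE ltr0n.
  have aL1 : 1 <= a * L.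
    by rewrite mulrC -ler_pdivrMr// div1r.
  have x0v : x0 < v.
    apply: (@lt_le_trans _ _ (`|x0| + 1)).
      by rewrite (le_lt_trans (ler_norm _))// ltrDl.
    rewrite /v mulrC -ler_pdivrMr// -[leLHS]ger0_norm; last first.
      by rewrite divr_ge0 ?addr_ge0// ltW.
    by rewrite -sqrtr_sqr ler_wsqrtr.
  have vL : v `^ alpha <= L / 2 by exact: powM.
  (* [Bad1]: no single step exceeds v. [Bad2]: some block longer than a L has ratio above v. *)
  pose Bad1 := \bigcap_(i in [set` iota 0 n]) (X i @^-1` `]-oo, v]%classic).
  pose A := long_exceed (fun k => (X k : T -> R)) (a * L) v.
  pose Bad2 := \big[setU/set0]_(j < n.+1) \big[setU/set0]_(i < n.+1) A j i.
  have P1 : (P Bad1 <= (expR (- (L / 2)))%:E)%E.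
    apply: le_trans (@prob_all_le _ _ _ _ _ _ (expR (- (L / 2))) _ indep ident _) _.
      apply: le_trans (ltW (tail _ x0v)).
      by rewrite lee_fin ler_expR lerN2.
    (* The exponent is n e^(-L/2) = e^(L/2), which exceeds L/2. *)
    rewrite lee_fin ler_expR lerN2 nL -expRD.
    have -> : L + - (L / 2) = L / 2 by lra.
    by have := expR_ge1Dx (L / 2); lra.
  have P2 : (P Bad2 <= (4 * expR (- (L / 2)))%:E)%E.
    apply: le_trans (@prob_long_exceed _ _ _ _ _ _ _ _ _ _ _ indep ident s0 a0
      L0 mgfb erefl) _.
    rewrite lee_fin.
    (* Since n + 1 <= 2n = 2 e^L, the union bound is at most 4 e^(2L) e^(-3L) = 4 e^(-L). *)
    have n2 : n.+1%:R <= 2 * expR L.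
      by rewrite -nL -natrM ler_nat mul2n -addnn -addn1 leq_add2l.
    apply: (@le_trans _ _ ((2 * expR L) ^+ 2 * expR (- (3 * L)))).
      by rewrite ler_wpM2r ?expR_ge0// ler_sqr ?nnegrE ?mulr_ge0 ?expR_ge0 ?ler0n.
    rewrite exprMn -expRM_natl -mulrA -expRD (_ : 2 ^+ 2 = 4); last by rewrite -natrX.
    by rewrite ler_pM2l// ler_expR; lra.
  have mA j i : measurable (A j i) by exact: measurable_long_exceed.
  have mBad1 : measurable Bad1.
    rewrite /Bad1 bigcap_seq; apply: bigsetI_measurable => i _.
    by rewrite -[X in measurable X]setTI; exact: mX.
  have mBad2 : measurable Bad2.
    by apply: bigsetU_measurable => j _; apply: bigsetU_measurable.
  (* Outside both bad events some step reaches v and no long block passes it, so [Mmax_eq_restr]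
     applies. *)
  have GBad : ~` G n `<=` Bad1 `|` Bad2.
    move=> w nGw; apply: contrapT => /not_orP[nBad1 nBad2]; apply: nGw.
    have [i0 /= i0n vX] : exists2 i0, (i0 < n)%N & v <= X i0 w.
      apply: contrapT => nex; apply: nBad1 => i /=.
      rewrite mem_iota /= add0n in_itv/= => iltn.
      by rewrite leNgt; apply/negP => vX; apply: nex; exists i => //; exact: ltW.
    apply: (Mmax_eq_restr _ _ _ v _ _ i0) => // i j /andP[ij jn] long.
    rewrite leNgt; apply/negP => big; apply: nBad2.
    have jn1 : (j < n.+1)%N by [].
    have in1 : (i < n.+1)%N by exact: ltn_trans ij jn1.
    rewrite /Bad2 (bigD1 (Ordinal jn1))//=; left.
    rewrite (bigD1 (Ordinal in1))//=; left.
    by rewrite /A /long_exceed /= ij long.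
  rewrite -[G n]setCK probability_setC; last exact: measurableC.
  rewrite EFinB; apply: leeB => //.
  apply: (@le_trans _ _ (P (Bad1 `|` Bad2))).
    by apply: le_measure; rewrite ?inE//; [exact: measurableC|exact: measurableU].
  apply: le_trans (measureU2 _ _ _) _ => //.
  apply: le_trans (leeD P1 P2) _.
  by rewrite -EFinD lee_fin -/L; lra.
have cvg1 : (1 - 5 * expR (- (ln n%:R / 2)) : R) @[n --> \oo] -->
    (1 - 5 * 0 : R).
  apply: cvgB; first exact: cvg_cst.
  apply: cvgMr.
  apply: (cvg_comp (fun n => ln n%:R / 2) (fun x : R => expR (- x)) _
    (@cvgr_expR R)).
  apply/cvgryPge => K; near=> n.
  by rewrite ler_pdivlMr//; near: n; exact: near_ge_ln.
rewrite mulr0 subr0 in cvg1.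
apply: (squeeze_cvge lowerP); last exact: cvg_cst.
by apply: cvg_EFin => //; near=> n.
Unshelve. all: by end_near. Qed.
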